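(* Let $\mathcal{C}$ be a monoidal category whose unit object $\underline{1}$ is a left $\otimes$-generator of $\mathcal{C}$, and let $A$ be an algebra in $\mathcal{C}$. Then $A$ is separable if and only if the forgetful functor $F:\mathcal{C}_A\to\mathcal{C}$ is a separable functor.
   Context: Monoidal categories are taken strict, with tensor product $\otimes$ and unit object $\underline{1}$. For an algebra $A$, $m_A$ and $\eta_A$ are its multiplication and unit, and $\mathcal{C}_A$ is the category of right $A$-modules in $\mathcal{C}$. An object $P$ of $\mathcal{C}$ is a left $\otimes$-generator of $\mathcal{C}$ if, whenever $f,g:Y\otimes Z\to W$ satisfy $f(\epsilon\otimes\mathrm{Id}_Z)=g(\epsilon\otimes\mathrm{Id}_Z)$ for all $\epsilon:P\to Y$ in $\mathcal{C}$, then $f=g$. An algebra $A$ is separable if there is a morphism $\gamma:A\to A\otimes A$ of $A$-bimodules with $m_A\gamma=\mathrm{Id}_A$, where $A$ and $A\otimes A$ are $A$-bimodules via $m_A$. A functor $\mathcal{F}:\mathcal{D}\to\mathcal{E}$ is separable if for all objects $X,Y$ of $\mathcal{D}$ there is a map $\mathcal{P}_{X,Y}:\mathrm{Hom}_{\mathcal{E}}(\mathcal{F}(X),\mathcal{F}(Y))\to\mathrm{Hom}_{\mathcal{D}}(X,Y)$ such that $\mathcal{P}_{X,Y}(\mathcal{F}(f))=f$ for all $f:X\to Y$, and $\mathcal{P}_{Y_1,Y_2}(g_2)\circ f_1=f_2\circ\mathcal{P}_{X_1,X_2}(g_1)$ whenever $f_1:X_1\to Y_1$, $f_2:X_2\to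 Y_2$ in $\mathcal{D}$ and $g_1:\mathcal{F}(X_1)\to\mathcal{F}(X_2)$, $g_2:\mathcal{F}(Y_1)\to\mathcal{F}(Y_2)$ in $\mathcal{E}$ satisfy $g_2\circ\mathcal{F}(f_1)=\mathcal{F}(f_2)\circ g_1$. *)

(* Defs.v *)
From mathcomp Require Import ssreflect ssrfun.
From Stdlib Require Import ProofIrrelevance.

Set Implicit Arguments.
Unset Strict Implicit.
Unset Printing Implicit Defensive.

Declare Scope cat_scope.
Delimit Scope cat_scope with cat.
Local Open Scope cat_scope.

Record category := Category {
  obj :> Type;
  hom : obj -> obj -> Type;
  idm : forall X, hom X X;
  comp : forall X Y Z, hom Y Z -> hom X Y -> hom X Z;
  comp_idl : forall X Y (f : hom X Y), comp (idm Y) f = f;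
  comp_idr : forall X Y (f : hom X Y), comp f (idm X) = f;
  compA : forall X Y Z T (h : hom Z T) (g : hom Y Z) (f : hom X Y),
    comp h (comp g f) = comp (comp h g) f
}.

Arguments hom {c} X Y.
Arguments idm {c} X.
Arguments comp {c X Y Z} g f.

Notation "g ∘ f" := (comp g f) (at level 40, left associativity) : cat_scope.

(* The identity morphism of an object, with its target rewritten along an
   equality of objects.  In a strict monoidal category equal objects such as
   (X ⊗ Y) ⊗ Z and X ⊗ (Y ⊗ Z) need not be convertible, so the identity between
   them has to be inserted explicitly; proof irrelevance makes it independent
   of the chosen equality proof. *)
Definition idto (C : category) (X Y : C) (e : X = Y) : hom X Y :=
  match e in _ = T return hom X T with erefl => idm X end.

Record functor (D E : category) := Functor {
  fobj :> D -> E;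
  fmor : forall X Y, hom X Y -> hom (fobj X) (fobj Y);
  fmor_id : forall X, fmor (idm X) = idm (fobj X);
  fmor_comp : forall X Y Z (g : hom Y Z) (f : hom X Y),
    fmor (g ∘ f) = fmor g ∘ fmor f
}.

Arguments fmor {D E} F {X Y} f : rename.

Definition separable_functor (D E : category) (F : functor D E) : Prop :=
  exists P : forall X Y : D, hom (F X) (F Y) -> hom X Y,
    (forall (X Y : D) (f : hom X Y), P X Y (fmor F f) = f) /\
    (forall (X1 X2 Y1 Y2 : D) (f1 : hom X1 Y1) (f2 : hom X2 Y2)
            (g1 : hom (F X1) (F X2)) (g2 : hom (F Y1) (F Y2)),
        g2 ∘ fmor F f1 = fmor F f2 ∘ g1 ->
        P Y1 Y2 g2 ∘ f1 = f2 ∘ P X1 X2 g1).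

(* Strictness: associativity and unitality are equalities of objects, and the
   last three axioms are the corresponding equalities of morphisms
   (f ⊗ g) ⊗ h = f ⊗ (g ⊗ h), Id ⊗ f = f and f ⊗ Id = f, read across these
   equalities of objects.  The coherence conditions hold automatically, since
   all the constraints are identities. *)
Record monoidal_category := MonoidalCategory {
  mcat :> category;
  tens : mcat -> mcat -> mcat;
  tensm : forall X X' Y Y' : mcat,
    hom X X' -> hom Y Y' -> hom (tens X Y) (tens X' Y');
  unit_obj : mcat;
  tensm_id : forall X Y : mcat, tensm (idm X) (idm Y) = idm (tens X Y);
  tensm_comp : forall (X X' X'' Y Y' Y'' : mcat)
      (f' : hom X' X'') (f : hom X X') (g' : hom Y' Y'') (g : hom Y Y'),
    tensm (f' ∘ f) (g' ∘ g) = tensm f' g' ∘ tensm f g;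
  tensA : forall X Y Z : mcat, tens (tens X Y) Z = tens X (tens Y Z);
  tens1o : forall X : mcat, tens unit_obj X = X;
  tenso1 : forall X : mcat, tens X unit_obj = X;
  tensmA : forall (X X' Y Y' Z Z' : mcat)
      (f : hom X X') (g : hom Y Y') (h : hom Z Z'),
    idto (tensA X' Y' Z') ∘ tensm (tensm f g) h =
    tensm f (tensm g h) ∘ idto (tensA X Y Z);
  tens1m : forall (X X' : mcat) (f : hom X X'),
    idto (tens1o X') ∘ tensm (idm unit_obj) f = f ∘ idto (tens1o X);
  tensm1 : forall (X X' : mcat) (f : hom X X'),
    idto (tenso1 X') ∘ tensm f (idm unit_obj) = f ∘ idto (tenso1 X)
}.

Arguments tens {m} X Y.
Arguments tensm {m X X' Y Y'} f g.
Arguments unit_obj {m}.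
Arguments tensA {m} X Y Z.
Arguments tens1o {m} X.
Arguments tenso1 {m} X.

Notation "X ⊗ Y" := (tens X Y) (at level 38, left associativity) : cat_scope.
Notation "f ⊗₁ g" := (tensm f g) (at level 38, left associativity) : cat_scope.

Definition left_tens_generator (C : monoidal_category) (P : C) : Prop :=
  forall (Y Z W : C) (f g : hom (Y ⊗ Z) W),
    (forall eps : hom P Y, f ∘ (eps ⊗₁ idm Z) = g ∘ (eps ⊗₁ idm Z)) -> f = g.

Section Coherence.
Context {C : monoidal_category}.
Implicit Types X Y Z : C.

Lemma idto_irr X Y (e e' : X = Y) : idto e = idto e'.
Proof. by rewrite (proof_irrelevance _ e e'). Qed.

Lemma idto_comp X Y Z (e : Y = Z) (e' : X = Y) :
  idto e ∘ idto e' = idto (etrans e' e).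
Proof. by case: _ / e; case: _ / e'; rewrite comp_idl. Qed.

Lemma idto_tensl X Y Z (e : X = Y) :
  idto e ⊗₁ idm Z = idto (congr1 (fun T => T ⊗ Z) e).
Proof. by case: _ / e; rewrite tensm_id. Qed.

Lemma idto_tensr X Y Z (e : X = Y) :
  idm Z ⊗₁ idto e = idto (congr1 (fun T => Z ⊗ T) e).
Proof. by case: _ / e; rewrite tensm_id. Qed.

Lemma idto_erefl X (e : X = X) : idto e = idm X.
Proof. exact: (idto_irr e erefl). Qed.

Lemma tensm_compl (X X' X'' Y : C) (f' : hom X' X'') (f : hom X X') :
  (f' ∘ f) ⊗₁ idm Y = (f' ⊗₁ idm Y) ∘ (f ⊗₁ idm Y).
Proof. by rewrite -tensm_comp comp_idl. Qed.

Lemma tensm_compr (X X' X'' Y : C) (f' : hom X' X'') (f : hom X X') :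
  idm Y ⊗₁ (f' ∘ f) = (idm Y ⊗₁ f') ∘ (idm Y ⊗₁ f).
Proof. by rewrite -tensm_comp comp_idl. Qed.

Lemma tensmA' (X X' Y Y' Z Z' : C)
    (f : hom X X') (g : hom Y Y') (h : hom Z Z') :
  idto (esym (tensA X' Y' Z')) ∘ (f ⊗₁ (g ⊗₁ h)) =
  f ⊗₁ g ⊗₁ h ∘ idto (esym (tensA X Y Z)).
Proof.
rewrite -[LHS]comp_idr -(idto_erefl (etrans (esym (tensA X Y Z)) (tensA X Y Z))).
by rewrite -idto_comp -compA (compA _ (idto (tensA X Y Z))) -tensmA !compA
           idto_comp idto_erefl comp_idl.
Qed.

End Coherence.

Record algebra (C : monoidal_category) := Algebra {
  alg_obj :> C;
  mul : hom (alg_obj ⊗ alg_obj) alg_obj;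
  one : hom unit_obj alg_obj;
  mulA : mul ∘ (mul ⊗₁ idm alg_obj) =
         mul ∘ (idm alg_obj ⊗₁ mul) ∘ idto (tensA alg_obj alg_obj alg_obj);
  mul1l : mul ∘ (one ⊗₁ idm alg_obj) = idto (tens1o alg_obj);
  mul1r : mul ∘ (idm alg_obj ⊗₁ one) = idto (tenso1 alg_obj)
}.

Arguments mul {C} A : rename.
Arguments one {C} A : rename.

Section Modules.
Context {C : monoidal_category}.
Variable A : algebra C.

Definition left_action (M : C) (l : hom (A ⊗ M) M) : Prop :=
  l ∘ (mul A ⊗₁ idm M) = l ∘ (idm A ⊗₁ l) ∘ idto (tensA A A M) /\
  l ∘ (one A ⊗₁ idm M) = idto (tens1o M).

Definition right_action (M : C) (r : hom (M ⊗ A) M) : Prop :=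
  r ∘ (r ⊗₁ idm A) = r ∘ (idm M ⊗₁ mul A) ∘ idto (tensA M A A) /\
  r ∘ (idm M ⊗₁ one A) = idto (tenso1 M).

Record right_module := RightModule {
  rmod_obj :> C;
  ract : hom (rmod_obj ⊗ A) rmod_obj;
  ractP : right_action ract
}.

Definition right_linear (M N : right_module) (f : hom M N) : Prop :=
  f ∘ ract M = ract N ∘ (f ⊗₁ idm A).

Definition rmod_hom (M N : right_module) := {f : hom M N | right_linear f}.

Record bimodule := Bimodule {
  bimod_obj :> C;
  bimod_lact : hom (A ⊗ bimod_obj) bimod_obj;
  bimod_ract : hom (bimod_obj ⊗ A) bimod_obj;
  bimod_lactP : left_action bimod_lact;
  bimod_ractP : right_action bimod_ract;
  bimod_compat :
    bimod_ract ∘ (bimod_lact ⊗₁ idm A) =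
    bimod_lact ∘ (idm A ⊗₁ bimod_ract) ∘ idto (tensA A bimod_obj A)
}.

Definition bimodule_morphism (M N : bimodule) (f : hom M N) : Prop :=
  f ∘ bimod_lact M = bimod_lact N ∘ (idm A ⊗₁ f) /\
  f ∘ bimod_ract M = bimod_ract N ∘ (f ⊗₁ idm A).

Lemma rmod_hom_eq (M N : right_module) (f g : rmod_hom M N) :
  proj1_sig f = proj1_sig g -> f = g.
Proof.
case: f g => [f Hf] [g Hg] /= E; case: _ / E Hg => Hg.
by rewrite (proof_irrelevance _ Hf Hg).
Qed.

Lemma right_linear_id (M : right_module) : right_linear (idm (rmod_obj M)).
Proof. by rewrite /right_linear tensm_id comp_idl comp_idr. Qed.

Lemma right_linear_comp (M N Q : right_module) (g : hom N Q) (f : hom M N) :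
  right_linear g -> right_linear f -> right_linear (g ∘ f).
Proof.
by move=> Hg Hf; rewrite /right_linear -compA Hf compA Hg -compA tensm_compl.
Qed.

Definition rmod_id (M : right_module) : rmod_hom M M :=
  exist _ (idm (rmod_obj M)) (right_linear_id M).

Definition rmod_comp (M N Q : right_module)
    (g : rmod_hom N Q) (f : rmod_hom M N) : rmod_hom M Q :=
  exist _ (proj1_sig g ∘ proj1_sig f)
    (right_linear_comp (proj2_sig g) (proj2_sig f)).

Lemma rmod_comp_idl M N (f : rmod_hom M N) : rmod_comp (rmod_id N) f = f.
Proof. by apply: rmod_hom_eq; rewrite /= comp_idl. Qed.

Lemma rmod_comp_idr M N (f : rmod_hom M N) : rmod_comp f (rmod_id M) = f.
Proof. by apply: rmod_hom_eq; rewrite /= comp_idr. Qed.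

Lemma rmod_compA M N Q R
    (h : rmod_hom Q R) (g : rmod_hom N Q) (f : rmod_hom M N) :
  rmod_comp h (rmod_comp g f) = rmod_comp (rmod_comp h g) f.
Proof. by apply: rmod_hom_eq; rewrite /= compA. Qed.

Definition right_modules : category :=
  Category rmod_comp_idl rmod_comp_idr rmod_compA.

Definition forgetful : functor right_modules C :=
  @Functor right_modules C rmod_obj (fun M N f => proj1_sig f)
    (fun _ => erefl) (fun _ _ _ _ _ => erefl).

Lemma mul_left_action : left_action (mul A).
Proof. by split; [exact: mulA | exact: mul1l]. Qed.

Lemma mul_right_action : right_action (mul A).
Proof. by split; [exact: mulA | exact: mul1r]. Qed.

Definition regular_bimodule : bimodule :=
  Bimodule mul_left_action mul_right_action (mulA A).

Definition square_lact : hom (A ⊗ (A ⊗ A)) (A ⊗ A) :=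
  (mul A ⊗₁ idm A) ∘ idto (esym (tensA A A A)).

Definition square_ract : hom ((A ⊗ A) ⊗ A) (A ⊗ A) :=
  (idm A ⊗₁ mul A) ∘ idto (tensA A A A).

Lemma square_left_action : left_action square_lact.
Proof.
rewrite /left_action /square_lact; split.
  rewrite -tensm_id -compA tensmA' compA -tensm_compl mulA !tensm_compl.
  rewrite -!compA (compA _ _ (idto (tensA A A (A ⊗ A)))) tensm_compr.
  rewrite !compA -[X in _ = X ∘ _ ∘ _]compA tensmA' !compA -!compA.
  congr (_ ∘ (_ ∘ _)).
  rewrite idto_tensl idto_tensr !idto_comp; exact: idto_irr.
rewrite -tensm_id -compA tensmA' compA -tensm_compl mul1l idto_tensl idto_comp.
exact: idto_irr.
Qed.

Lemma square_right_action : right_action square_ract.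
Proof.
rewrite /right_action /square_ract; split.
  rewrite tensm_compl compA -[X in X ∘ _ = _]compA tensmA -tensm_id.
  rewrite -[X in _ = X ∘ _]compA tensmA !compA -!tensm_compr mulA tensm_compr.
  rewrite -!compA; congr (_ ∘ _).
  rewrite idto_tensl idto_tensr !idto_comp; exact: idto_irr.
rewrite -tensm_id -compA tensmA compA -tensm_compr mul1r idto_tensr idto_comp.
exact: idto_irr.
Qed.

Lemma square_compat :
  square_ract ∘ (square_lact ⊗₁ idm A) =
  square_lact ∘ (idm A ⊗₁ square_ract) ∘ idto (tensA A (A ⊗ A) A).
Proof.
rewrite /square_ract /square_lact tensm_compl tensm_compr !compA.
rewrite -[in LHS](compA _ (idto _)) tensmA -[in RHS](compA _ (idto _)) tensmA'.
rewrite !compA -!tensm_comp !tensm_id !comp_idl !comp_idr -!compA; congr (_ ∘ _).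
rewrite idto_tensl idto_tensr !idto_comp; exact: idto_irr.
Qed.

Definition square_bimodule : bimodule :=
  Bimodule square_left_action square_right_action square_compat.

Definition separable_algebra : Prop :=
  exists gamma : hom A (A ⊗ A),
    @bimodule_morphism regular_bimodule square_bimodule gamma /\
    mul A ∘ gamma = idm A.

End Modules.

(* Main.v *)
(* If [gamma] is a bilinear section of the multiplication, the averaging
   [P g = r_N (g (x) A) (r_M (x) A) (M (x) gamma eta)] turns any [g : M -> N] of
   the base category into a right linear morphism, fixes the right linear ones
   and is natural.  Conversely, apply [P] to the section [A (x) eta] of the
   multiplication: naturality against the multiplication itself gives a section
   [gamma], and naturality against left multiplication by every
   [eps : unit -> A] gives left linearity, since the unit object is a
   generator. *)

From mathcomp Require Import ssreflect ssrfun.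
Require Import Defs.

Set Implicit Arguments.
Unset Strict Implicit.
Unset Printing Implicit Defensive.

Local Open Scope cat_scope.

(** * Interchange law and strict unit constraints *)

Section Tensor.
Context {C : monoidal_category}.
Implicit Types X Y Z : C.

Lemma tensm_lr X X' Y Y' (f : hom X X') (g : hom Y Y') :
  (f ⊗₁ idm Y') ∘ (idm X ⊗₁ g) = f ⊗₁ g.
Proof. by rewrite -tensm_comp comp_idl comp_idr. Qed.

Lemma tensm_rl X X' Y Y' (f : hom X X') (g : hom Y Y') :
  (idm X' ⊗₁ g) ∘ (f ⊗₁ idm Y) = f ⊗₁ g.
Proof. by rewrite -tensm_comp comp_idl comp_idr. Qed.

Lemma idtoK X Y (e : X = Y) : idto (esym e) ∘ idto e = idm X.
Proof. by rewrite idto_comp idto_erefl. Qed.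

Lemma idtoKV X Y (e : X = Y) : idto e ∘ idto (esym e) = idm Y.
Proof. by rewrite idto_comp idto_erefl. Qed.

Lemma tens1m' X X' (f : hom X X') :
  idm unit_obj ⊗₁ f ∘ idto (esym (tens1o X)) = idto (esym (tens1o X')) ∘ f.
Proof.
rewrite -[LHS]comp_idl -(idtoK (tens1o X')) -!compA; congr (_ ∘ _).
by rewrite compA tens1m -compA idtoKV comp_idr.
Qed.

Lemma tensm1' X X' (f : hom X X') :
  f ⊗₁ idm unit_obj ∘ idto (esym (tenso1 X)) = idto (esym (tenso1 X')) ∘ f.
Proof.
rewrite -[LHS]comp_idl -(idtoK (tenso1 X')) -!compA; congr (_ ∘ _).
by rewrite compA tensm1 -compA idtoKV comp_idr.
Qed.

(** The triangle identity: both sides are identities between equal objects. *)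
Lemma tens_unit_mid X Y :
  idto (tensA X unit_obj Y) ∘ (idto (esym (tenso1 X)) ⊗₁ idm Y) =
  idm X ⊗₁ idto (esym (tens1o Y)).
Proof. rewrite idto_tensl idto_tensr idto_comp; exact: idto_irr. Qed.

End Tensor.

(** * Tensoring with the unit of the algebra *)

Section InsertOne.
Context {C : monoidal_category} (A : algebra C).
Implicit Types X Y : C.

(** The unit of the adjunction between free modules and [forgetful]; in elements, [x] goes to
    [x ⊗ 1]. *)
Definition insert_one X : hom X (X ⊗ A) :=
  (idm X ⊗₁ one A) ∘ idto (esym (tenso1 X)).

Lemma insert_one_nat X Y (f : hom X Y) :
  insert_one Y ∘ f = (f ⊗₁ idm A) ∘ insert_one X.
Proof.
rewrite /insert_one -compA -tensm1' !compA; congr (_ ∘ _).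
by rewrite tensm_lr tensm_rl.
Qed.

Lemma ract_insert_one (M : right_module A) : ract M ∘ insert_one M = idm M.
Proof. by rewrite /insert_one compA (proj2 (ractP M)) idtoKV. Qed.

End InsertOne.

(** * Averaging along a bilinear section *)

Section Averaging.
Context {C : monoidal_category} (A : algebra C).
Variable gamma : hom A (A ⊗ A).
Hypothesis gamma_left :
  gamma ∘ mul A = square_lact A ∘ (idm A ⊗₁ gamma).
Hypothesis gamma_right :
  gamma ∘ mul A = square_ract A ∘ (gamma ⊗₁ idm A).
Hypothesis gamma_section : mul A ∘ gamma = idm A.
Implicit Types M N : right_module A.

(** The average before its argument in [A] is set to 1: writing [gamma a] as a sum of [a' ⊗ a''], it
    sends [m ⊗ a] to the sum of [g (m a') a'']. *)
Definition avg_ext M N (g : hom M N) : hom (M ⊗ A) N :=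
  ract N ∘ ((g ∘ ract M) ⊗₁ idm A) ∘ idto (esym (tensA M A A)) ∘
  (idm M ⊗₁ gamma).

Definition avg M N (g : hom M N) : hom M N := avg_ext g ∘ insert_one A M.

(** Left linearity turns [gamma (b a)] into the sum of [b a' ⊗ a''], and [m (b a') = (m b) a'] in
    [M]. *)
Lemma avg_ext_balanced M N (g : hom M N) :
  avg_ext g ∘ (ract M ⊗₁ idm A) =
  avg_ext g ∘ (idm M ⊗₁ mul A) ∘ idto (tensA M A A).
Proof.
have [rA _] := ractP M.
rewrite /avg_ext -2![in RHS]compA (compA _ _ (idto _)) -tensm_compr gamma_left.
rewrite /square_lact !tensm_compr -!compA.
rewrite tensm_rl -(tensm_lr (ract M)) -{1}tensm_id.
rewrite (compA (idto _) (ract M ⊗₁ _)) tensmA'.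
rewrite -tensmA -(compA _ (idto _)).
rewrite (compA (idto _) (idm M ⊗₁ (mul A ⊗₁ idm A))) tensmA' -!compA.
congr (_ ∘ _); rewrite !(compA (_ ⊗₁ idm A)) -!tensm_compl -!compA rA.
rewrite !(compA g) (tensm_compl _ _ (idto _)) tensm_id -!compA; congr (_ ∘ _).
rewrite !compA; congr (_ ∘ _).
rewrite idto_tensl idto_tensr !idto_comp; exact: idto_irr.
Qed.

(** Right linearity of [gamma] lets a factor on the right of [a] come out behind [a''], where
    associativity of the action on [N] absorbs it. *)
Lemma avg_ext_linear M N (g : hom M N) :
  ract N ∘ (avg_ext g ⊗₁ idm A) =
  avg_ext g ∘ (idm M ⊗₁ mul A) ∘ idto (tensA M A A).
Proof.
have [rA _] := ractP N.
rewrite /avg_ext -2![in RHS]compA (compA _ _ (idto _)) -tensm_compr gamma_right.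
rewrite /square_ract !tensm_compr (tensm_compl _ _ (idm M ⊗₁ _)).
rewrite (tensm_compl _ (_ ∘ _)) (tensm_compl _ (ract N)) !compA rA.
rewrite -!compA; congr (_ ∘ _).
rewrite -tensmA (compA (idto _) (idm M ⊗₁ (_ ⊗₁ _))) tensmA'.
rewrite (compA (idto _) (_ ⊗₁ idm A ⊗₁ _)) tensmA -!compA.
rewrite !(compA (_ ⊗₁ _) (_ ⊗₁ _)) !tensm_id tensm_rl tensm_lr; congr (_ ∘ _).
rewrite !compA; congr (_ ∘ _).
rewrite idto_tensl idto_tensr !idto_comp; exact: idto_irr.
Qed.

Lemma avg_ext_insert_one M N (g : hom M N) :
  avg_ext g ∘ (idm M ⊗₁ mul A) ∘ idto (tensA M A A) ∘
  (insert_one A M ⊗₁ idm A) = avg_ext g.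
Proof.
rewrite /insert_one tensm_compl -!compA (compA (idto _) (_ ⊗₁ _ ⊗₁ _)) tensmA.
rewrite -!compA tens_unit_mid -!tensm_compr.
by rewrite (compA (mul A)) mul1l idtoKV comp_idr /avg_ext !compA.
Qed.

(** Balancedness moves [a] across the tensor sign in [m a ⊗ 1], giving [m ⊗ a 1]. *)
Lemma avg_ract M N (g : hom M N) : avg g ∘ ract M = avg_ext g.
Proof.
rewrite /avg -compA insert_one_nat compA avg_ext_balanced.
rewrite /insert_one -!(compA (avg_ext g)) -!(compA (idm M ⊗₁ mul A)).
rewrite (compA (idto (tensA M A A))) -tensm_id tensmA.
rewrite !(compA (idm M ⊗₁ mul A)) -tensm_compr mul1r idto_tensr.
by rewrite !idto_comp idto_erefl comp_idr.
Qed.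

Lemma avg_linear M N (g : hom M N) : right_linear (avg g).
Proof.
rewrite /right_linear avg_ract /avg tensm_compl compA avg_ext_linear.
by rewrite avg_ext_insert_one.
Qed.

(** For linear [f], each [f (m a') a''] is [f (m (a' a''))], and the products [a' a''] sum to
    [a]. *)
Lemma avg_right_linear M N (f : hom M N) : right_linear f -> avg f = f.
Proof.
move=> fl; have [rA _] := ractP M.
have -> : avg f = f ∘ ract M ∘ insert_one A M; last first.
  by rewrite -compA ract_insert_one comp_idr.
rewrite /avg /avg_ext tensm_compl (compA (ract N)) -fl; congr (_ ∘ _).
rewrite -2!(compA f) rA -!compA (compA (idto _)) idtoKV comp_idl.
by rewrite -tensm_compr gamma_section tensm_id comp_idr.
Qed.

Lemma avg_nat M1 M2 N1 N2 (f1 : hom M1 N1) (f2 : hom M2 N2)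
    (g1 : hom M1 M2) (g2 : hom N1 N2) :
  right_linear f1 -> right_linear f2 -> g2 ∘ f1 = f2 ∘ g1 ->
  avg g2 ∘ f1 = f2 ∘ avg g1.
Proof.
move=> fl1 fl2 E.
rewrite /avg -compA insert_one_nat !compA; congr (_ ∘ _).
rewrite /avg_ext -(compA _ (idm N1 ⊗₁ _)) tensm_rl -(tensm_lr f1) -tensm_id.
rewrite -!compA (compA (idto _) (f1 ⊗₁ _)) tensmA' !compA.
rewrite -(compA _ (_ ⊗₁ idm A) (_ ⊗₁ idm A)) -tensm_compl -compA.
rewrite -(compA g2) -fl1 (compA g2) E -(compA f2) tensm_compl.
by rewrite (compA (ract N2)) -fl2 !compA.
Qed.

End Averaging.

Lemma separable_algebra_functor (C : monoidal_category) (A : algebra C) :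
  separable_algebra A -> separable_functor (forgetful A).
Proof.
case=> gamma [[gl gr] gs].
exists (fun M N g => exist _ (avg gamma g) (avg_linear gl gr g)).
split=> [M N [f fl]|M1 M2 N1 N2 [f1 fl1] [f2 fl2] g1 g2 /= E].
  by apply: rmod_hom_eq => /=; exact: avg_right_linear.
by apply: rmod_hom_eq => /=; exact: avg_nat.
Qed.

(** * Recovering a bilinear section from the functor *)

Section Converse.
Context {C : monoidal_category} (A : algebra C).

Definition regular_module : right_module A :=
  RightModule (mul_right_action A).

Definition square_module : right_module A :=
  RightModule (square_right_action A).

Lemma mul_right_linear :
  @right_linear C A square_module regular_module (mul A).
Proof. by rewrite /right_linear /= /square_ract compA mulA. Qed.

Definition lmul (eps : hom unit_obj A) : hom A A :=
  mul A ∘ (eps ⊗₁ idm A) ∘ idto (esym (tens1o A)).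

Lemma lmul_right_linear eps :
  @right_linear C A regular_module regular_module (lmul eps).
Proof.
rewrite /right_linear /= /lmul !tensm_compl -!compA -tens1m'.
rewrite (compA (eps ⊗₁ _)) tensm_lr -tensm_rl !compA mulA.
rewrite -(compA _ (idto _)) tensmA tensm_id -!compA.
do 3!congr (_ ∘ _).
rewrite idto_tensl idto_comp; exact: idto_irr.
Qed.

Lemma lmul_tens_right_linear eps :
  @right_linear C A square_module square_module (lmul eps ⊗₁ idm A).
Proof.
rewrite /right_linear /= /square_ract compA tensm_lr -tensm_rl -!compA.
by rewrite tensmA tensm_id.
Qed.

(** Makes left linearity testable on elements: restricted along [eps], it becomes commutation with
    left multiplication by [eps]. *)
Lemma square_lact_lmul eps (f : hom A (A ⊗ A)) :
  square_lact A ∘ (idm A ⊗₁ f) ∘ (eps ⊗₁ idm A) =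
  (lmul eps ⊗₁ idm A) ∘ f ∘ idto (tens1o A).
Proof.
rewrite -(compA (square_lact A)) tensm_rl -tensm_lr.
rewrite -tensm_id /square_lact /lmul !compA -(compA _ _ (eps ⊗₁ _)) tensmA' !tensm_compl.
rewrite -!compA -tens1m !compA; congr (_ ∘ _); rewrite -!compA.
do 2!congr (_ ∘ _).
rewrite idto_tensl idto_comp; exact: idto_irr.
Qed.

Lemma separable_functor_algebra :
  left_tens_generator (@unit_obj C) ->
  separable_functor (forgetful A) -> separable_algebra A.
Proof.
move=> gen [P [PF Pnat]].
pose g : hom (forgetful A regular_module) (forgetful A square_module) :=
  insert_one A A.
pose gamma := P _ _ g.
exists (proj1_sig gamma); split; last first.
  have E : mul A ∘ g = idm A := ract_insert_one regular_module.
  (* The naturality square is [idm ∘ idm = mul A ∘ g]; since [P] fixes the identity, it yields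
     [idm = mul A ∘ gamma]. *)
  have := Pnat _ _ _ _ (idm (regular_module : right_modules A))
    (exist _ _ mul_right_linear
     : @hom (right_modules A) square_module regular_module)
    g (idm _).
  rewrite /= E comp_idl => /(_ erefl).
  rewrite (PF regular_module regular_module (rmod_id regular_module)).
  by move/(congr1 (@proj1_sig _ _)); rewrite /= comp_idl => <-.
(* Right linearity is free: [gamma] is already a morphism of right modules. *)
split; last exact: (proj2_sig gamma).
apply: gen => eps.
have := Pnat _ _ _ _
  (exist _ _ (lmul_right_linear eps)
    : @hom (right_modules A) regular_module regular_module)
  (exist _ _ (lmul_tens_right_linear eps)
    : @hom (right_modules A) square_module square_module) g g.
(* The square required by [Pnat] is naturality of [insert_one] at [lmul eps]. *)
move=> /(_ (insert_one_nat _ _)).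
move/(congr1 (@proj1_sig _ _)); rewrite /= -/gamma => E.
rewrite square_lact_lmul -E /lmul -!compA.
by rewrite idtoK comp_idr.
Qed.

End Converse.

Theorem proposition4p2 (C : monoidal_category)
    (hgen : left_tens_generator (@unit_obj C)) (A : algebra C) :
  separable_algebra A <-> separable_functor (forgetful A).
Proof.
split; first exact: separable_algebra_functor.
exact: separable_functor_algebra.
Qed.
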